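(* Let $K$ be a graph with five distinct marked vertices $a,b,c,d,e$. For $\{u,v,w,z\}=\{a,b,c,d\}$ let $G(u,v;w,z)$ be the graph obtained from $K$ by adding three new vertices $f,g,h$ and seven new edges numbered $1=\{f,u\}$, $2=\{g,v\}$, $3=\{h,w\}$, $4=\{h,z\}$, $5=\{f,e\}$, $6=\{f,g\}$, $7=\{g,h\}$. Set $$G_1=G(d,a;b,c),\quad G_2=G(a,d;b,c),\quad G_3=G(b,c;a,d),\quad G_4=G(c,b;a,d).$$ Then the denominators $D^7_{G_i}=D^7_{G_i}(1,\dots,7)$ of the seven new edges, each of which is defined up to sign, satisfy, for a suitable choice of signs, $$\pm D^7_{G_1}\pm D^7_{G_2}\pm D^7_{G_3}\pm D^7_{G_4}=0 .$$
   Context: For a graph $G$ orient the edges and let $\mathcal{E}_G$ be the (edges)$\times$(vertices) incidence matrix, with entry $1$ if $e$ begins (and does not end) at $v$, $-1$ if $e$ ends (and does not begin) at $v$, and $0$ otherwise. Let $A$ be the diagonal matrix with entries the edge variables $x_e$, and let $M_G$ be obtained from $\begin{pmatrix}A&\mathcal{E}_G\\-\mathcal{E}_G^T&0\end{pmatrix}$ by deleting the row and the column indexed by one chosen vertex. For edge sets $I,J$ with $|I|=|J|$, $\Psi_G^{I,J}$ is the determinant of $M_G$ with rows indexed by $I$ and columns indexed by $J$ removed (well defined up to sign). These polynomials have degree at most one in each variable. We write e.g. $\Psi^{ij,kl}$ for $\Psi^{\{i,j\},\{k,l\}}$. For polynomials $f=f^1x+f_1$ and $g=g^1x+g_1$ of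 degree at most one in $x$, the resultant is $[f,g]_x=f^1g_1-f_1g^1$. The five-invariant of distinct edges $i,j,k,l,m$ is ${}^5\Psi_G(i,j,k,l,m)=\pm[\Psi_G^{ij,kl},\Psi_G^{ik,jl}]_{x_m}$, well defined up to sign and, up to sign, independent of the order of the edges. Denominator reduction: $D^5_G(1,\dots,5)=\pm{}^5\Psi_G(1,\dots,5)$. If $D^n_G(1,\dots,n)$ is defined and factorizes as a product $FH$ of two polynomials of degree at most one in $x_{n+1}$, then $D^{n+1}_G(1,\dots,n+1)=\pm[F,H]_{x_{n+1}}$ (well defined up to sign). *)

(* Defs.v *)
From HB Require Import structures.
From mathcomp Require Import all_boot all_order all_algebra.
From mathcomp Require Export mpoly.

Set Implicit Arguments.
Unset Strict Implicit.
Unset Printing Implicit Defensive.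

Import GRing.Theory.
Local Open Scope ring_scope.

(* A finite multigraph (parallel edges and self-loops allowed): each edge has
   two ends, listed in an order that carries no meaning.  An orientation is a
   separate Boolean choice for every edge. *)
Definition mgraph (V E : finType) := E -> V * V.

Definition orientation (E : finType) := E -> bool.

Definition edge_begin (V E : finType) (G : mgraph V E) (o : orientation E)
    (e : E) : V := if o e then (G e).1 else (G e).2.

Definition edge_end (V E : finType) (G : mgraph V E) (o : orientation E)
    (e : E) : V := if o e then (G e).2 else (G e).1.

(* Polynomials over the integers in the edge variables x_e, e : E; the variable
   x_e is the mpoly variable of index [enum_rank e]. *)
Notation epoly E := {mpoly int[#|{: E}|]}.

Section Polynomials.

Variable E : finType.

(* The isomorphism Z[x_E] = (Z[x_E without x_e])[x_e], read inside
   {poly Z[x_E]}: 'X stands for x_e, and the coefficients do not involve x_e. *)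
Definition in_var (e : E) (p : epoly E) : {poly epoly E} :=
  mmap (polyC \o @mpolyC #|{: E}| int)
       (fun i => if i == enum_rank e then 'X else ('X_i)%:P) p.

Definition at_most_linear (e : E) (p : epoly E) : bool :=
  (size (in_var e p) <= 2)%N.

Definition resultant1 (e : E) (f g : epoly E) : epoly E :=
  (in_var e f)`_1 * (in_var e g)`_0 - (in_var e f)`_0 * (in_var e g)`_1.

End Polynomials.

(* The determinant of M with the rows in I and the columns in J removed.
   It is meant for #|I| = #|J|; the default value of [nth] is then not used. *)
Definition det_remove (R : comNzRingType) (n : nat) (M : 'M[R]_n)
    (I J : {set 'I_n}) : R :=
  \det (\matrix_(i < #|~: I|, j < #|~: I|)
          M (enum_val i) (nth (enum_val i) (enum (~: J)) j)).

Section GraphPolynomials.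

Variables (V E : finType) (G : mgraph V E).

Definition incidence_entry (o : orientation E) (e : E) (v : V) : int :=
  if (edge_begin G o e == v) && (edge_end G o e != v) then 1
  else if (edge_end G o e == v) && (edge_begin G o e != v) then -1
  else 0.

Definition incidence_mx (o : orientation E) :
    'M[epoly E]_(#|{: E}|, #|{: V}|) :=
  \matrix_(i, j) (incidence_entry o (enum_val i) (enum_val j))%:~R.

Definition full_mx (o : orientation E) :
    'M[epoly E]_(#|{: E}| + #|{: V}|) :=
  block_mx (diag_mx (\row_i 'X_i)) (incidence_mx o)
           (- (incidence_mx o)^T) 0.

Definition edge_index (e : E) : 'I_(#|{: E}| + #|{: V}|) :=
  lshift _ (enum_rank e).

Definition vertex_index (v : V) : 'I_(#|{: E}| + #|{: V}|) :=
  rshift _ (enum_rank v).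

(* Psi_G^{I,J}, for the orientation o and the deleted vertex v0. *)
Definition dodgson (o : orientation E) (v0 : V) (I J : {set E}) : epoly E :=
  det_remove (full_mx o) (vertex_index v0 |: (edge_index @: I))
                         (vertex_index v0 |: (edge_index @: J)).

(* "P is the five-invariant": the orientation, the deleted vertex and the sign,
   on which the five-invariant depends only up to sign, are all left free. *)
Definition is_five_invariant (i j k l m : E) (P : epoly E) : Prop :=
  exists (o : orientation E) (v0 : V) (s : bool),
    P = (-1) ^+ s *
        resultant1 m (dodgson o v0 [set i; j] [set k; l])
                     (dodgson o v0 [set i; k] [set j; l]).

(* [is_denominator es D]: D is one of the two sign choices of D^n_G(es) where
   n = size es; it holds for no D when the denominator is not defined. *)
Inductive is_denominator : seq E -> epoly E -> Prop :=
| denominator_five (i j k l m : E) (P : epoly E) :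
    uniq [:: i; j; k; l; m] ->
    is_five_invariant i j k l m P ->
    is_denominator [:: i; j; k; l; m] P
| denominator_step (es : seq E) (e : E) (D F H : epoly E) (s : bool) :
    is_denominator es D ->
    e \notin es ->
    D = F * H ->
    at_most_linear e F ->
    at_most_linear e H ->
    is_denominator (rcons es e) ((-1) ^+ s * resultant1 e F H).

End GraphPolynomials.

Definition attachV (V : finType) : finType := (V + 'I_3)%type.
Definition attachE (E : finType) : finType := (E + 'I_7)%type.

Section Attach.

Variables (V E : finType) (K : mgraph V E) (e : V).

Definition new_f : attachV V := inr (@Ordinal 3 0 isT).
Definition new_g : attachV V := inr (@Ordinal 3 1 isT).
Definition new_h : attachV V := inr (@Ordinal 3 2 isT).

Definition new_ends (u v w z : V) : 7.-tuple (attachV V * attachV V) :=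
  [tuple (new_f, inl u); (new_g, inl v); (new_h, inl w); (new_h, inl z);
         (new_f, inl e); (new_f, new_g); (new_g, new_h)].

(* The graph G(u,v;w,z); the new edge numbered k+1 is [inr k]. *)
Definition attach (u v w z : V) : mgraph (attachV V) (attachE E) :=
  fun x => match x with
           | inl y => (inl (K y).1, inl (K y).2)
           | inr k => tnth (new_ends u v w z) k
           end.

End Attach.

Definition new_edges (E : finType) : seq (attachE E) :=
  [seq inr k | k <- enum 'I_7].

(* Main.v *)
Require Import Defs.
From HB Require Import structures.
From mathcomp Require Import all_boot all_order all_algebra.
From mathcomp Require Import mpoly.
From mathcomp Require Import perm ring.

Set Implicit Arguments.
Unset Strict Implicit.
Unset Printing Implicit Defensive.

Import GRing.Theory.
Local Open Scope ring_scope.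

(** Write Psi^{12,34} and Psi^{13,24} for the two Dodgson polynomials whose
    resultant in x_5 is the five-invariant.  Both are determinants of the same
    matrix, with some rows and columns removed, and their dependence on x_5,
    x_6, x_7 is read off from the stars of the three new vertices: a monomial
    vanishes when it deletes so many edges that the row or the column of f, g
    or h becomes zero.  This gives
      Psi^{12,34} = A + x_5 B + x_6 C,
      Psi^{13,24} = A' + x_5 B' + x_6 C' + x_7 (D' + x_5 E'),
    with coefficients free of the new variables
    ([dodgson_12_34_expand], [dodgson_13_24_expand]).  The five-invariant is
    then linear in x_6 and in x_7, so each of the last two reductions may use
    the trivial factor 1, and D^7 is the coefficient -C E' of x_6 x_7
    ([three_reductions]).

    Let L be the matrix of K with the row and the column of e deleted.
    Contracting and deleting the new edges shows that E' is det L up to sign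
    ([coef_x5x7_value]) and that C is, up to sign, Y(u,z) - Y(u,w), where
    Y(x,y) is the determinant of L with the row of x and the column of y
    replaced by the unit entry at (x,y) ([coef_x6_value]).  Hence
      D^7_{G(u,v;w,z)} = +- det L (Y(u,z) - Y(u,w)).
    Since Y is symmetric ([old_cofactor_sym]), the four differences
    Y(d,c) - Y(d,b), Y(a,c) - Y(a,b), Y(b,d) - Y(b,a), Y(c,d) - Y(c,a), taken
    with the signs +, -, +, -, add up to zero.

    To speak of the denominator one needs its uniqueness up to sign
    ([is_denominator_unique]).  For the five-invariant it is the independence
    of Dodgson polynomials from the orientation and the deleted vertex
    ([dodgson_clear]).  For a reduction step it holds because the square of
    the resultant of F and H is the discriminant of F H, whatever the
    factorization ([resultant1_sqr]).

    Removing rows and columns changes the index type of a matrix.  Throughout,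
    the removed lines are instead filled with the unit entries of a chosen
    pairing of removed rows with removed columns; this keeps the index type
    fixed and turns successive expansions into growing lists of pairs. *)

(** * Determinants over a finite index type *)

(** Locked, as is [clear] below, so that two of these determinants are compared
    by their arguments and never by unfolding. *)
HB.lock Definition fdet (R : comNzRingType) (T : finType) (f : T -> T -> R) : R :=
  \det (\matrix_(i < #|T|, j < #|T|) f (enum_val i) (enum_val j)).

(** For a list of pairs with distinct first and distinct second components,
    the determinant of [clear s f] is up to sign the minor of [f] without the
    rows [unzip1 s] and the columns [unzip2 s]. *)
HB.lock Definition clear (R : pzSemiRingType) (T : eqType) (s : seq (T * T))
    (f : T -> T -> R) (i j : T) : R :=
  if (i \in unzip1 s) || (j \in unzip2 s) then ((i, j) \in s)%:R else f i j.

Section Fdet.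

Variables (R : comNzRingType) (T : finType).
Implicit Types (f : T -> T -> R) (s : seq (T * T)).

Lemma fdetE f :
  fdet f = \det (\matrix_(i < #|T|, j < #|T|) f (enum_val i) (enum_val j)).
Proof. by rewrite fdet.unlock. Qed.

Lemma eq_fdet f g : f =2 g -> fdet f = fdet g.
Proof.
by move=> fg; rewrite !fdetE; congr (\det _); apply/matrixP=> i j;
rewrite !mxE fg.
Qed.

Lemma fdet_tr f : fdet (fun i j => f j i) = fdet f.
Proof.
by rewrite !fdetE -det_tr; congr (\det _); apply/matrixP=> i j; rewrite !mxE.
Qed.

Lemma fdet_scale (x y : T -> R) f :
  fdet (fun i j => x i * f i j * y j) = \prod_i x i * fdet f * \prod_i y i.
Proof.
pose D (z : T -> R) := diag_mx (\row_(i < #|T|) z (enum_val i)).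
have detD z : \det (D z) = \prod_i z i.
  rewrite det_diag (reindex _ (onW_bij _ (@enum_val_bij T))) /=.
  by apply: eq_bigr => i _; rewrite mxE.
rewrite !fdetE -!detD -!det_mulmx; congr (\det _); apply/matrixP=> i j.
by rewrite mul_mx_diag mul_diag_mx !mxE.
Qed.

Lemma det_reindex n (h h' : 'I_n -> T) f : bijective h -> bijective h' ->
  exists b : bool, \det (\matrix_(i, j) f (h i) (h' j)) = (-1) ^+ b * fdet f.
Proof.
move=> bh bh'; rewrite fdetE.
have nT : n = #|T| by rewrite -(bij_eq_card bh) card_ord.
subst n.
have inj_r (k : 'I_#|T| -> T) : bijective k -> injective (fun i => enum_rank (k i)).
  by move=> bk i j /enum_rank_inj /(bij_inj bk).
pose p := perm (inj_r _ bh); pose q := perm (inj_r _ bh').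
exists (odd_perm p (+) odd_perm q).
have -> : \matrix_(i, j) f (h i) (h' j) =
    row_perm p (col_perm q (\matrix_(i, j) f (enum_val i) (enum_val j))).
  by apply/matrixP=> i j; rewrite !mxE !permE !enum_rankK.
rewrite row_permE col_permE !det_mulmx !det_perm odd_permV.
by rewrite signr_addb [RHS]mulrAC mulrA.
Qed.

Lemma clearE s f i j : clear s f i j =
  if (i \in unzip1 s) || (j \in unzip2 s) then ((i, j) \in s)%:R else f i j.
Proof. by rewrite clear.unlock. Qed.

Lemma eq_clear s f g :
  (forall i j, i \notin unzip1 s -> j \notin unzip2 s -> f i j = g i j) ->
  clear s f =2 clear s g.
Proof.
move=> fg i j; rewrite !clearE; case: ifP => // /negbT.
by rewrite negb_or => /andP[si sj]; apply: fg.
Qed.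

Lemma clear_perm s t f : perm_eq s t -> clear s f =2 clear t f.
Proof.
move=> st i j; rewrite !clearE (perm_mem st).
by rewrite (perm_mem (perm_map fst st)) (perm_mem (perm_map snd st)).
Qed.

Definition flip s : seq (T * T) := [seq (x.2, x.1) | x <- s].

Lemma unzip1_flip s : unzip1 (flip s) = unzip2 s.
Proof. by rewrite /unzip1 -map_comp. Qed.

Lemma unzip2_flip s : unzip2 (flip s) = unzip1 s.
Proof. by rewrite /unzip2 -map_comp. Qed.

Lemma clear_tr s f i j : clear (flip s) (fun i j => f j i) i j = clear s f j i.
Proof.
rewrite !clearE unzip1_flip unzip2_flip orbC.
suff -> : ((i, j) \in flip s) = ((j, i) \in s) by [].
rewrite -[(i, j)]/((fun x : T * T => (x.2, x.1)) (j, i)) mem_map //.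
by move=> [? ?] [? ?] [-> ->].
Qed.

Lemma fdet_clear_tr s f :
  fdet (clear (flip s) (fun i j => f j i)) = fdet (clear s f).
Proof. by rewrite -fdet_tr; apply: eq_fdet => i j; apply: clear_tr. Qed.

(** Laplace expansion: the cofactor at (p, q) is itself a cleared determinant,
    because clearing row p and column q leaves a single term in the expansion
    of that determinant along row p. *)
Lemma fdet_row s f p : p \notin unzip1 s ->
  fdet (clear s f) =
  \sum_(q | q \notin unzip2 s) f p q * fdet (clear ((p, q) :: s) f).
Proof.
move=> ps; rewrite {1}fdetE (expand_det_row _ (enum_rank p)).
rewrite (reindex_onto (@enum_rank T) enum_val) /=; last first.
  by move=> i _; rewrite enum_valK.
rewrite (eq_bigl predT); last by move=> q; rewrite enum_rankK eqxx.
rewrite [RHS]big_mkcond; apply: eq_bigr => q _.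
rewrite mxE !enum_rankK !clearE (negbTE ps) /=.
have psq : (p, q) \notin s by apply: contra ps => ps; apply/mapP; exists (p, q).
case: ifP => [qs|qs]; rewrite ?(negbTE psq) ?qs ?mul0r //=.
congr (_ * _); rewrite !fdetE.
rewrite (expand_det_row _ (enum_rank p)) (bigD1 (enum_rank q)) //= big1 ?addr0.
  rewrite mxE !enum_rankK !clearE !mem_head mul1r.
  rewrite /cofactor; congr (_ * \det _); apply/matrixP=> i j; rewrite !mxE.
  have neq (x : T) (y : 'I_#|T|.-1) :
      (enum_val (lift (enum_rank x) y) == x) = false.
    apply/negbTE; rewrite -[X in _ != X]enum_rankK (inj_eq enum_val_inj).
    by rewrite eq_sym neq_lift.
  by rewrite !clearE /= !inE xpair_eqE !neq.
move=> j jq; rewrite mxE enum_rankK !clearE !inE eqxx /= xpair_eqE eqxx /=.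
have -> : (p, enum_val j) \in s = false.
  by apply: contraNF ps => ps; apply/mapP; exists (p, enum_val j).
by rewrite orbF -[q]enum_rankK (inj_eq enum_val_inj) (negbTE jq) mul0r.
Qed.

Lemma fdet_col s f q : q \notin unzip2 s ->
  fdet (clear s f) =
  \sum_(p | p \notin unzip1 s) f p q * fdet (clear ((p, q) :: s) f).
Proof.
move=> qs; rewrite -fdet_clear_tr (fdet_row _ (p := q)) ?unzip1_flip // unzip2_flip.
by apply: eq_bigr => p _; rewrite -(fdet_clear_tr ((p, q) :: s)).
Qed.

Lemma pivot_row s f p q : p \notin unzip1 s -> q \notin unzip2 s ->
  (forall j, j \notin unzip2 s -> j != q -> f p j = 0) ->
  fdet (clear s f) = f p q * fdet (clear ((p, q) :: s) f).
Proof.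
move=> ps qs f0; rewrite (fdet_row _ ps) (bigD1 q) //= big1 ?addr0 //.
by move=> j /andP[js jq]; rewrite f0 ?mul0r.
Qed.

Lemma pivot_col s f p q : p \notin unzip1 s -> q \notin unzip2 s ->
  (forall i, i \notin unzip1 s -> i != p -> f i q = 0) ->
  fdet (clear s f) = f p q * fdet (clear ((p, q) :: s) f).
Proof.
move=> ps qs f0; rewrite (fdet_col _ qs) (bigD1 p) //= big1 ?addr0 //.
by move=> j /andP[js jq]; rewrite f0 ?mul0r.
Qed.

Lemma fdet_col2 s f p p' q :
    p \notin unzip1 s -> p' \notin unzip1 s -> p' != p -> q \notin unzip2 s ->
    (forall i, i \notin unzip1 s -> i != p -> i != p' -> f i q = 0) ->
  fdet (clear s f) = f p q * fdet (clear ((p, q) :: s) f)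
                   + f p' q * fdet (clear ((p', q) :: s) f).
Proof.
move=> ps ps' pp qs f0; rewrite (fdet_col _ qs) (bigD1 p) //= (bigD1 p') ?ps' //=.
rewrite big1 ?addr0 // => j /andP[/andP[js jp] jp'].
by rewrite f0 ?mul0r.
Qed.

(** Exchanging the rows p and p' exchanges their partners. *)
Lemma fdet_swap s f p p' q q' :
    p \notin unzip1 s -> p' \notin unzip1 s -> p != p' ->
  fdet (clear [:: (p, q), (p', q') & s] f) =
  - fdet (clear [:: (p', q), (p, q') & s] f).
Proof.
move=> ps ps' pp; rewrite !fdetE.
have pp' : (p' == p) = false by rewrite eq_sym (negbTE pp).
set A := \matrix_(i, j) _; set B := \matrix_(i, j) _.
suff -> : A = row_perm (tperm (enum_rank p) (enum_rank p')) B.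
  rewrite row_permE det_mulmx det_perm odd_tperm (inj_eq enum_rank_inj) pp.
  by rewrite expr1 mulN1r.
have nin k (j : T) : k \notin unzip1 s -> (k, j) \in s = false.
  by move=> ks; apply: contraNF ks => kj; apply/mapP; exists (k, j).
apply/matrixP=> i j; rewrite !mxE !clearE /= !inE !xpair_eqE.
case: tpermP => [->|->|/eqP ip /eqP ip']; rewrite ?enum_rankK.
- by rewrite !nin // !eqxx ?(negbTE pp) ?pp' /= ?orbT ?orbF.
- by rewrite !nin // !eqxx ?(negbTE pp) ?pp' /= ?orbT ?orbF.
have -> : enum_val i == p = false.
  by apply: contraNF ip => /eqP <-; rewrite enum_valK.
have -> : enum_val i == p' = false.
  by apply: contraNF ip' => /eqP <-; rewrite enum_valK.
by rewrite /=; congr (if _ || _ then _ else _); rewrite orbCA.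
Qed.

Lemma fdet_row0 s f p : p \notin unzip1 s ->
  (forall j, j \notin unzip2 s -> f p j = 0) -> fdet (clear s f) = 0.
Proof.
by move=> ps f0; rewrite (fdet_row _ ps) big1 // => j js; rewrite f0 ?mul0r.
Qed.

Lemma fdet_col0 s f q : q \notin unzip2 s ->
  (forall i, i \notin unzip1 s -> f i q = 0) -> fdet (clear s f) = 0.
Proof.
by move=> qs f0; rewrite (fdet_col _ qs) big1 // => j js; rewrite f0 ?mul0r.
Qed.

Lemma fdet_ker f (x : T -> R) p :
  (forall i, \sum_j f i j * x j = 0) -> x p = 1 -> fdet f = 0.
Proof.
move=> fx xp; rewrite fdetE.
set A := \matrix_(i, j) f (enum_val i) (enum_val j) : 'M_#|T|.
pose c := \col_(j < #|T|) x (enum_val j).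
have Ac : A *m c = 0.
  apply/matrixP=> i k; rewrite !mxE -[RHS](fx (enum_val i)).
  rewrite [RHS](reindex _ (onW_bij _ (@enum_val_bij T))) /=.
  by apply: eq_bigr => j _; rewrite !mxE.
have : (\adj A *m A *m c) (enum_rank p) 0 = 0 by rewrite -mulmxA Ac mulmx0 mxE.
by rewrite mul_adj_mx mul_scalar_mx !mxE enum_rankK xp mulr1.
Qed.

End Fdet.

(** * Equality up to sign *)

Definition eqpm (R : pzRingType) (x y : R) := exists b : bool, x = (-1) ^+ b * y.

Section Eqpm.
Variable R : comNzRingType.
Implicit Types x y z : R.

Lemma eqpm_refl x : eqpm x x.
Proof. by exists false; rewrite mul1r. Qed.

Lemma eqpm_sym x y : eqpm x y -> eqpm y x.
Proof. by case=> b ->; exists b; rewrite signrMK. Qed.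

Lemma eqpm_trans y x z : eqpm x y -> eqpm y z -> eqpm x z.
Proof. by case=> b -> [c ->]; exists (b (+) c); rewrite signr_addb mulrA. Qed.

Lemma eqpm_sign (b : bool) x : eqpm ((-1) ^+ b * x) x.
Proof. by exists b. Qed.

Lemma eqpm_opp x : eqpm (- x) x.
Proof. by exists true; rewrite mulN1r. Qed.

Lemma eqpmM x x' y y' : eqpm x x' -> eqpm y y' -> eqpm (x * y) (x' * y').
Proof.
by case=> b -> [c ->]; exists (b (+) c); rewrite signr_addb mulrACA.
Qed.

End Eqpm.

(** * Removed rows and columns as cleared ones *)

Section DetRemove.
Variable R : comNzRingType.

(** After moving the removed rows and columns to the end, in the order of the
    list, the cleared matrix is block diagonal with the minor and an identity
    matrix as blocks.  The reordering is responsible for the sign. *)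
Lemma det_remove_clear n (M : 'M[R]_n) (s : seq ('I_n * 'I_n)) :
    uniq (unzip1 s) -> uniq (unzip2 s) ->
  eqpm (det_remove M [set i in unzip1 s] [set j in unzip2 s]) (fdet (clear s M)).
Proof.
move=> u1 u2; rewrite /det_remove.
set I := [set i in unzip1 s]; set J := [set j in _].
pose m := #|~: I|; pose k := size s.
have cI : #|I| = k by rewrite cardsE (card_uniqP u1) size_map.
have cJ : #|J| = k by rewrite cardsE (card_uniqP u2) size_map.
have mk : (m + k = n)%N by rewrite addnC -cI cardsC card_ord.
have cJ' : size (enum (~: J)) = m.
  by rewrite -cardE; apply: (@addnI #|J|); rewrite cardsC cJ card_ord addnC mk.
pose t (x : 'I_k) := tnth (in_tuple s) x.
have ts x : t x \in s by apply: mem_tnth.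
pose h (i : 'I_(m + k)) := match split i with
  | inl x => enum_val x | inr x => (t x).1 end.
pose h' (j : 'I_(m + k)) := match split j with
  | inl x => nth (enum_val x) (enum (~: J)) x | inr x => (t x).2 end.
have hl x : h (lshift k x) = enum_val x by rewrite /h (unsplitK (inl x)).
have hr x : h (rshift m x) = (t x).1 by rewrite /h (unsplitK (inr x)).
have hl' x : h' (lshift k x) = nth (enum_val x) (enum (~: J)) x.
  by rewrite /h' (unsplitK (inl x)).
have hr' x : h' (rshift m x) = (t x).2 by rewrite /h' (unsplitK (inr x)).
have lI x : h (lshift k x) \notin unzip1 s.
  by rewrite hl; have := enum_valP x; rewrite !inE.
have lJ x : h' (lshift k x) \notin unzip2 s.
  have := @mem_nth _ (enum_val x) (enum (~: J)) x.
  by rewrite hl' cJ' ltn_ord mem_enum !inE => ->.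
have rI x : h (rshift m x) \in unzip1 s by rewrite hr; apply: map_f.
have rJ x : h' (rshift m x) \in unzip2 s by rewrite hr'; apply: map_f.
have tE x y : ((t x).1 == (t y).1) = (x == y) /\
    ((t x).2 == (t y).2) = (x == y).
  have tn z z0 : t z = nth z0 s z by rewrite /t (tnth_nth z0).
  have [z0 _] : {z0 | z0 = t x} by exists (t x).
  rewrite !(tn _ z0).
  rewrite -!(nth_map z0 z0.1 fst) ?ltn_ord //.
  rewrite -!(nth_map z0 z0.2 snd) ?ltn_ord //.
  by rewrite !nth_uniq ?size_map ?ltn_ord.
have inj_h : injective h.
  move=> i j; case: (split_ordP i) => x ->; case: (split_ordP j) => y -> e.
  - by move: e; rewrite !hl => /enum_val_inj ->.
  - by move: (lI x); rewrite e rI.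
  - by move: (lI y); rewrite -e rI.
  - by move/eqP: e; rewrite !hr (tE x y).1 => /eqP ->.
have inj_h' : injective h'.
  move=> i j; case: (split_ordP i) => x ->; case: (split_ordP j) => y -> e.
  - move/eqP: e; rewrite !hl'.
    rewrite (@set_nth_default _ _ (enum_val y) (enum_val x)) ?cJ' //.
    rewrite nth_uniq ?cJ' ?enum_uniq //.
    by move=> /eqP/val_inj ->.
  - by move: (lJ x); rewrite e rJ.
  - by move: (lJ y); rewrite -e rJ.
  - by move/eqP: e; rewrite !hr' (tE x y).2 => /eqP ->.
have bij k' : injective k' -> bijective (k' : 'I_(m + k) -> 'I_n).
  by move=> ik; apply: inj_card_bij ik _; rewrite !card_ord mk.
have [b] := det_reindex (clear s M) (bij _ inj_h) (bij _ inj_h').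
set B := \matrix_(i, j) _; move=> detB.
apply: (@eqpm_trans _ (\det B)); last by exists b.
suff -> : B = block_mx
    (\matrix_(i, j) M (enum_val i) (nth (enum_val i) (enum (~: J)) j)) 0 0 1%:M.
  by rewrite det_ublock det1 mulr1; apply: eqpm_refl.
apply/matrixP=> i j; rewrite mxE !clearE.
case: (split_ordP i) => x ->; case: (split_ordP j) => y ->.
- rewrite (negbTE (lI x)) (negbTE (lJ y)) block_mxEul mxE hl hl'.
  by congr (M _ _); apply: set_nth_default; rewrite cJ'.
- rewrite rJ orbT block_mxEur mxE.
  have : (h (lshift k x), h' (rshift m y)) \notin s; last by move/negbTE=> ->.
  by apply: contra (lI x) => ?; apply/mapP;
     exists (h (lshift k x), h' (rshift m y)).
- rewrite rI block_mxEdl mxE.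
  have : (h (rshift m x), h' (lshift k y)) \notin s; last by move/negbTE=> ->.
  by apply: contra (lJ y) => ?; apply/mapP;
     exists (h (rshift m x), h' (lshift k y)).
- rewrite rI block_mxEdr mxE hr hr'; congr (_%:R); congr nat_of_bool.
  apply/idP/eqP => [|->]; last by rewrite -surjective_pairing.
  move=> /(@tnthP _ _ (in_tuple s))[z zE].
  have [z1 z2] : (t x).1 = (t z).1 /\ (t y).2 = (t z).2 by rewrite /t -zE.
  move/eqP: z1; rewrite (tE x z).1 => /eqP ->.
  by move/eqP: z2; rewrite (tE y z).2 => /eqP ->.
Qed.

(** Reversing the orientation of edges multiplies rows and columns by signs. *)
Lemma det_remove_scale n (M : 'M[R]_n) (x y : 'I_n -> bool) (I J : {set 'I_n}) :
    #|I| = #|J| ->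
  eqpm (det_remove (\matrix_(i, j) ((-1) ^+ x i * M i j * (-1) ^+ y j)) I J)
       (det_remove M I J).
Proof.
move=> IJ; rewrite /det_remove.
set B := \matrix_(i, j) _; set A := \matrix_(i, j) M _ _.
have prod_sign (z : 'I_#|~: I| -> bool) : eqpm (\prod_i ((-1) ^+ z i : R)) 1.
  apply: (big_ind (fun u => eqpm u 1)) => [|u v u1 v1|i _]; first exact: eqpm_refl.
    by rewrite -[1]mulr1; apply: eqpmM.
  by rewrite -[X in eqpm X]mulr1; apply: eqpm_sign.
pose D (z : 'I_#|~: I| -> bool) : 'M[R]_#|~: I| := diag_mx (\row_i (-1) ^+ z i).
have detD z : eqpm (\det (D z)) 1.
  by rewrite det_diag; under eq_bigr do rewrite mxE; apply: prod_sign.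
have cJ : size (enum (~: J)) = #|~: I|.
  by rewrite -cardE; apply: (@addnI #|J|); rewrite cardsC -IJ cardsC.
case: (set_0Vmem (~: I)) => [I0|[i0 i0I]].
  suff -> : A = B by apply: eqpm_refl.
  have m0 : #|~: I| = 0%N by rewrite I0 cards0.
  by apply/matrixP=> i; have := ltn_ord i; rewrite [X in (_ < X)%N]m0.
have -> : B = D (fun i => x (enum_val i)) *m A *m
              D (fun j => y (nth i0 (enum (~: J)) j)).
  apply/matrixP=> i j; rewrite mul_mx_diag mul_diag_mx !mxE.
  by rewrite (set_nth_default i0) ?cJ.
rewrite !det_mulmx -[X in eqpm _ X]mulr1 -[X in eqpm _ (X * _)]mul1r.
by apply: eqpmM => //; apply: eqpmM => //; apply: eqpm_refl.
Qed.

End DetRemove.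

(** * Changing the pairing of cleared rows and columns *)

Section Pairing.
Variables (R : comNzRingType) (T : finType).
Implicit Types (f g : T -> T -> R) (s t : seq (T * T)).

Lemma fdet_bij (T' : finType) (h : T -> T') (f : T' -> T' -> R) : bijective h ->
  eqpm (fdet (fun i j => f (h i) (h j))) (fdet f).
Proof.
move=> bh; have bj : bijective (fun i : 'I_#|T| => h (enum_val i)).
  exact: bij_comp bh (@enum_val_bij T).
rewrite [X in eqpm X _]fdetE; exact: (det_reindex f bj bj).
Qed.

Lemma clear_map (T' : finType) (h : T -> T') (f : T' -> T' -> R) s i j :
    injective h ->
  clear [seq (h x.1, h x.2) | x <- s] f (h i) (h j) =
  clear s (fun i j => f (h i) (h j)) i j.
Proof.
move=> ih; rewrite !clearE /unzip1 /unzip2 -!map_comp.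
have mem1 (p : T * T -> T) k : (h k \in map (h \o p) s) = (k \in map p s).
  by rewrite map_comp mem_map.
rewrite (mem1 fst) (mem1 snd).
suff -> : ((h i, h j) \in [seq (h x.1, h x.2) | x <- s]) = ((i, j) \in s) by [].
rewrite (mem_map (f := fun x => (h x.1, h x.2)) _ s (i, j)) //.
by move=> [? ?] [? ?] [/ih -> /ih ->].
Qed.

Lemma fdet_mul f g : fdet (fun i j => \sum_k f i k * g k j) = fdet f * fdet g.
Proof.
rewrite !fdetE -det_mulmx; congr (\det _); apply/matrixP=> i j; rewrite !mxE.
rewrite (reindex _ (onW_bij _ (@enum_val_bij T))) /=.
by apply: eq_bigr => k _; rewrite !mxE.
Qed.

Lemma fdet_id : fdet (fun i j : T => (i == j)%:R : R) = 1.
Proof.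
rewrite !fdetE -[RHS](det1 _ #|T|); congr (\det _); apply/matrixP=> i j.
by rewrite !mxE (inj_eq enum_val_inj).
Qed.

Lemma eqpm_clear s t f : uniq (unzip1 s) -> uniq (unzip2 s) ->
    perm_eq (unzip1 s) (unzip1 t) -> perm_eq (unzip2 s) (unzip2 t) ->
  eqpm (fdet (clear s f)) (fdet (clear t f)).
Proof.
move=> u1 u2 p1 p2.
pose M := \matrix_(i, j) f (enum_val i) (enum_val j) : 'M[R]_#|T|.
pose r (s : seq (T * T)) := [seq (enum_rank x.1, enum_rank x.2) | x <- s].
have r1 s' : unzip1 (r s') = map enum_rank (unzip1 s').
  by rewrite /unzip1 -!map_comp.
have r2 s' : unzip2 (r s') = map enum_rank (unzip2 s').
  by rewrite /unzip2 -!map_comp.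
have clear_remove s' : uniq (unzip1 s') -> uniq (unzip2 s') ->
    eqpm (fdet (clear s' f))
         (det_remove M [set i in unzip1 (r s')] [set i in unzip2 (r s')]).
  move=> v1 v2; have b := @enum_rank_bij T.
  have w1 : uniq (unzip1 (r s')) by rewrite r1 (map_inj_uniq enum_rank_inj).
  have w2 : uniq (unzip2 (r s')) by rewrite r2 (map_inj_uniq enum_rank_inj).
  apply: eqpm_trans (eqpm_sym (det_remove_clear _ w1 w2)).
  apply: eqpm_trans (fdet_bij (clear (r s') M) b).
  have -> : fdet (fun i j => clear (r s') M (enum_rank i) (enum_rank j)) =
      fdet (clear s' f).
    apply: eq_fdet => i j; rewrite clear_map; last exact: enum_rank_inj.
    by apply: eq_clear => ? ? _ _; rewrite mxE !enum_rankK.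
  exact: eqpm_refl.
apply: eqpm_trans (clear_remove _ u1 u2) _; apply: eqpm_sym.
have -> : [set i in unzip1 (r s)] = [set i in unzip1 (r t)].
  by apply/setP=> i; rewrite !inE !r1; apply/perm_mem/perm_map.
have -> : [set i in unzip2 (r s)] = [set i in unzip2 (r t)].
  by apply/setP=> i; rewrite !inE !r2; apply/perm_mem/perm_map.
by apply: clear_remove; rewrite -?(perm_uniq p1) -?(perm_uniq p2).
Qed.

(** When the same set A of rows and columns is cleared, the sign caused by the
    choice of the pairing is the determinant of a permutation matrix supported
    on A.  It depends neither on the matrix nor on the further cleared lines,
    which is what allows differences of minors to be compared. *)
Lemma clear_sign (A : seq T) t :
    uniq A -> perm_eq (unzip1 t) A -> perm_eq (unzip2 t) A ->
  exists b : bool, forall f s,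
    (forall i, i \in A -> i \notin unzip1 s) ->
    (forall j, j \in A -> j \notin unzip2 s) ->
  fdet (clear (t ++ s) f) =
  (-1) ^+ b * fdet (clear ([seq (x, x) | x <- A] ++ s) f).
Proof.
move=> uA p1 p2; pose d := [seq (x, x) | x <- A].
have d1 : unzip1 d = A by rewrite /unzip1 -map_comp map_id.
have d2 : unzip2 d = A by rewrite /unzip2 -map_comp map_id.
have dE i j : ((i, j) \in d) = (i == j) && (j \in A).
  apply/mapP/andP => [[x xA [-> ->]]|[/eqP -> jA]]; first by rewrite eqxx.
  by exists j.
have u1 : uniq (unzip1 t) by rewrite (perm_uniq p1).
have u2 : uniq (unzip2 t) by rewrite (perm_uniq p2).
pose P := clear t (fun i j => (i == j)%:R : R).
have [b detP] : eqpm (fdet P) 1.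
  rewrite -fdet_id; have -> : fdet (fun i j : T => (i == j)%:R : R) =
      fdet (clear d (fun i j => (i == j)%:R : R)).
    apply: eq_fdet => i j; rewrite !clearE d1 d2 dE; case: ifP => // h.
    by case: eqP h => // ->; rewrite orbb => ->.
  by apply: eqpm_clear; rewrite ?d1 ?d2.
exists b => f s As1 As2; rewrite -[(-1) ^+ b]mulr1 -detP -fdet_mul.
apply: eq_fdet => i j.
have tA1 k : (k \in unzip1 t) = (k \in A) by apply: perm_mem.
have tA2 k : (k \in unzip2 t) = (k \in A) by apply: perm_mem.
(* each row has only one partner in [t] *)
have un k l l' : (k, l) \in t -> (k, l') \in t -> l = l'.
  move=> kl kl'.
  have := uniqP k u1 (index (k, l) t) (index (k, l') t).
  rewrite !inE !size_map !index_mem => /(_ kl kl').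
  rewrite !(nth_map (k, l)) ?index_mem // !nth_index // => /(_ erefl).
  by move=> /(congr1 (nth (k, l) t)); rewrite !nth_index // => -[].
have cat1 (x : seq (T * T)) : unzip1 (x ++ s) = unzip1 x ++ unzip1 s.
  exact: map_cat.
have cat2 (x : seq (T * T)) : unzip2 (x ++ s) = unzip2 x ++ unzip2 s.
  exact: map_cat.
have [iA|iA] := boolP (i \in A).
  have /mapP[[i' l] il /= ei] : i \in unzip1 t by rewrite tA1.
  subst i'.
  have lA : l \in A by rewrite -tA2; apply/mapP; exists (i, l).
  rewrite (bigD1 l) //= big1 ?addr0 => [|k kl]; last first.
    rewrite /P !clearE tA1 iA /=.
    case: (boolP (_ \in t)) => [ik|]; rewrite ?mul0r //.
    by rewrite (un _ _ _ ik il) eqxx in kl.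
  rewrite /P [clear t _ _ _]clearE tA1 iA il mul1r.
  rewrite !clearE !cat1 !cat2 !mem_cat d1 tA1 iA lA dE /=.
  have -> : (i, j) \in s = false.
    by apply: contraNF (As1 _ iA) => ij; apply/mapP; exists (i, j).
  have -> : (l, j) \in s = false.
    by apply: contraNF (As1 _ lA) => ij; apply/mapP; exists (l, j).
  rewrite !orbF; congr ((nat_of_bool _)%:R).
  apply/idP/andP => [ij|[/eqP <- _]] //.
  by rewrite (un _ _ _ il ij) eqxx -tA2; split=> //; apply/mapP; exists (i, j).
rewrite (bigD1 i) //= big1 ?addr0 => [|k kl]; last first.
  rewrite /P !clearE tA1 (negbTE iA) /=; case: ifP => [kA|_].
    have -> : (i, k) \in t = false; last by rewrite mul0r.
    by apply: contraNF iA => ij; rewrite -tA1; apply/mapP; exists (i, k).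
  by rewrite eq_sym (negbTE kl) mul0r.
rewrite /P [clear t _ _ _]clearE tA1 tA2 (negbTE iA) eqxx mul1r.
rewrite !clearE !cat1 !cat2 !mem_cat d1 d2 tA1 tA2 dE.
have -> : (i, j) \in t = false.
  by apply: contraNF iA => ij; rewrite -tA1; apply/mapP; exists (i, j).
by case: eqP => //= ij; subst j; rewrite (negbTE iA).
Qed.

(** If the columns in A add up to zero, all cofactors of a row at columns in A
    agree: replacing this row by the difference of two unit vectors makes the
    indicator vector of A a kernel vector. *)
Lemma clear_move_col f s (A : pred T) p q q' :
    p \notin unzip1 s -> (forall j, j \in unzip2 s -> ~~ A j) -> A q -> A q' ->
    (forall i, i \notin unzip1 s -> i != p -> \sum_(j | A j) f i j = 0) ->
  fdet (clear ((p, q) :: s) f) = fdet (clear ((p, q') :: s) f).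
Proof.
move=> ps As Aq Aq' f0.
have qs k : A k -> k \notin unzip2 s by move=> Ak; apply: contraL Ak; apply: As.
pose f' i j := if i == p then (j == q)%:R - (j == q')%:R else f i j.
have f'E k : fdet (clear ((p, k) :: s) f') = fdet (clear ((p, k) :: s) f).
  apply: eq_fdet; apply: eq_clear => i j.
  rewrite /f' inE negb_or => /andP[ip _] _.
  by rewrite (negbTE ip).
apply/eqP; rewrite -subr_eq0; apply/eqP.
(* the cleared matrix of f' kills the indicator vector of A *)
have detf' : fdet (clear s f') = 0.
  apply: (@fdet_ker _ _ _ (fun j => (A j)%:R) q); last by rewrite Aq.
  move=> i; under eq_bigr do rewrite mulr_natr mulrb.
  rewrite -big_mkcond /=.
  have [is1|is1] := boolP (i \in unzip1 s).
    rewrite big1 // => j Aj; rewrite !clearE is1 /=.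
    have -> // : (i, j) \in s = false.
    by apply: contraNF (qs _ Aj) => ij; apply/mapP; exists (i, j).
  rewrite (eq_bigr (f' i)) => [|j Aj]; last first.
    by rewrite !clearE (negbTE is1) (negbTE (qs _ Aj)).
  rewrite /f'; have [_|ip] := eqVneq i p; last by apply: f0.
  rewrite sumrB; have s1 k : A k -> \sum_(j | A j) ((j == k)%:R : R) = 1.
    move=> Ak; rewrite (bigD1 k) //= eqxx big1 ?addr0 //.
    by move=> j /andP[_ /negbTE ->].
  by rewrite !s1 // subrr.
rewrite -!f'E -detf' (fdet_row _ ps).
have pick k : A k ->
    \sum_(j | j \notin unzip2 s) (j == k)%:R * fdet (clear ((p, j) :: s) f') =
    fdet (clear ((p, k) :: s) f').
  move=> Ak; rewrite (bigD1 k) ?qs //= eqxx mul1r big1 ?addr0 //.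
  by move=> j /andP[_ /negbTE ->]; rewrite mul0r.
rewrite -(pick q) // -(pick q') // -sumrB; apply: eq_bigr => j _.
by rewrite /f' eqxx mulrBl.
Qed.

Lemma clear_move_row f s (A : pred T) p p' q :
    q \notin unzip2 s -> (forall j, j \in unzip1 s -> ~~ A j) -> A p -> A p' ->
    (forall j, j \notin unzip2 s -> j != q -> \sum_(i | A i) f i j = 0) ->
  fdet (clear ((p, q) :: s) f) = fdet (clear ((p', q) :: s) f).
Proof.
move=> qs As Ap Ap' f0; rewrite -fdet_clear_tr -[RHS]fdet_clear_tr /=.
by apply: (@clear_move_col _ _ A); rewrite ?unzip1_flip ?unzip2_flip.
Qed.

End Pairing.

Section FdetMap.
Variables (R R' : comNzRingType) (h : {rmorphism R -> R'}) (T : finType).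

Lemma fdet_map (f : T -> T -> R) : h (fdet f) = fdet (fun i j => h (f i j)).
Proof.
rewrite !fdetE -det_map_mx; congr (\det _).
by apply/matrixP=> i j; rewrite !mxE.
Qed.

Lemma clear_rmorph s (f : T -> T -> R) i j :
  h (clear s f i j) = clear s (fun i j => h (f i j)) i j.
Proof. by rewrite !clearE; case: ifP; rewrite ?rmorph_nat. Qed.

End FdetMap.


(** * The matrix of a graph and the Dodgson polynomials *)

Section Network.
Variables (V E : finType) (G : mgraph V E).

Definition inc (R : comNzRingType) (x : E) (v : V) : R :=
  ((G x).1 == v)%:R - ((G x).2 == v)%:R.

(** The matrix defining the graph polynomials, with all edges oriented from
    their first to their second end, edge weights in an arbitrary ring, and
    rows and columns indexed by edges and vertices instead of ordinals. *)
Definition net (R : comNzRingType) (wt : E -> R) (i j : E + V) : R :=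
  match i, j with
  | inl x, inl y => if x == y then wt x else 0
  | inl x, inr v => inc R x v
  | inr v, inl x => - inc R x v
  | inr _, inr _ => 0
  end.

Definition edge_pairs (s : seq (E * E)) : seq ((E + V) * (E + V)) :=
  [seq (inl x.1, inl x.2) | x <- s].

Lemma unzip1_edge_pairs s : unzip1 (edge_pairs s) = map inl (unzip1 s).
Proof. by rewrite /unzip1 -!map_comp. Qed.

Lemma unzip2_edge_pairs s : unzip2 (edge_pairs s) = map inl (unzip2 s).
Proof. by rewrite /unzip2 -!map_comp. Qed.

Lemma notin_edges (s : seq E) (v : V) : (inr v : E + V) \notin map inl s.
Proof. by apply/mapP=> -[]. Qed.

(** The entries of an edge row at the vertex columns, and those of an edge
    column at the vertex rows, add up to zero. *)
Lemma vertex_indep (R : comNzRingType) (wt : E -> R) s v w :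
  fdet (clear ((inr v, inr v) :: edge_pairs s) (net wt)) =
  fdet (clear ((inr w, inr w) :: edge_pairs s) (net wt)).
Proof.
pose A (x : E + V) := if x is inr _ then true else false.
have sumA (F : E + V -> R) : \sum_(x | A x) F x = \sum_u F (inr u).
  by rewrite big_mkcond big_sumType /= big1 ?add0r.
have inc0 x : \sum_u inc R x u = 0.
  rewrite sumrB; have s1 y : \sum_(u : V) ((y == u)%:R : R) = 1.
    rewrite (bigD1 y) //= eqxx big1 ?addr0 // => u.
    by rewrite eq_sym => /negbTE ->.
  by rewrite !s1 subrr.
have nA (t : seq E) j : j \in [seq (inl x : E + V) | x <- t] -> ~~ A j.
  by case/mapP=> x _ ->.
rewrite (@clear_move_col _ _ _ _ A _ _ (inr w)) ?unzip1_edge_pairs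
  ?unzip2_edge_pairs ?notin_edges //; last first.
- by move=> [x|u] _ _; rewrite sumA /=; [apply: inc0 | apply: big1].
- exact: nA.
apply: (@clear_move_row _ _ _ _ A);
  rewrite ?unzip1_edge_pairs ?unzip2_edge_pairs ?notin_edges //.
- exact: nA.
- by move=> [x|u] _ _; rewrite sumA /= ?sumrN ?inc0 ?oppr0 //; apply: big1.
Qed.

Definition xvar (x : E) : epoly E := 'X_(enum_rank x).

(** The right-hand side does not involve [o] and [v0], so Dodgson polynomials
    do not depend on the orientation and the deleted vertex up to sign. *)
Lemma dodgson_clear o v0 v s : uniq (unzip1 s) -> uniq (unzip2 s) ->
  eqpm (dodgson G o v0 [set x in unzip1 s] [set x in unzip2 s])
       (fdet (clear ((inr v, inr v) :: edge_pairs s) (net xvar))).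
Proof.
move=> u1 u2; rewrite (vertex_indep _ _ v v0).
pose h (x : E + V) : 'I_(#|E| + #|V|) := match x with
  inl y => edge_index V y | inr u => vertex_index E u end.
have ih : injective h.
  move=> [x|u] [y|w] //= /eqP; rewrite /edge_index /vertex_index
    ?(eq_lshift, eq_rshift, eq_rlshift, eq_lrshift) //.
  - by move=> /eqP/enum_rank_inj ->.
  - by move=> /eqP/enum_rank_inj ->.
have bh : bijective h by apply: inj_card_bij => //; rewrite card_ord card_sum.
pose t := (inr v0, inr v0) :: edge_pairs s.
pose r := [seq (h x.1, h x.2) | x <- t].
have r1 : unzip1 r = map h (unzip1 t) by rewrite /unzip1 -!map_comp.
have r2 : unzip2 r = map h (unzip2 t) by rewrite /unzip2 -!map_comp.
have t1 : unzip1 t = inr v0 :: map inl (unzip1 s).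
  by rewrite /= unzip1_edge_pairs.
have t2 : unzip2 t = inr v0 :: map inl (unzip2 s).
  by rewrite /= unzip2_edge_pairs.
have inl_inj : injective (@inl E V) by move=> ? ? [].
have w1 : uniq (unzip1 r).
  by rewrite r1 map_inj_uniq // t1 /= map_inj_uniq // u1 notin_edges.
have w2 : uniq (unzip2 r).
  by rewrite r2 map_inj_uniq // t2 /= map_inj_uniq // u2 notin_edges.
have setE q : vertex_index E v0 |: (@edge_index V E @: [set x in q]) =
    [set i in map h (inr v0 :: map inl q)].
  apply/setP=> i; rewrite map_cons -map_comp !inE; congr (_ || _).
  by apply/imsetP/mapP => -[x xq ->]; exists x; rewrite ?inE // in xq *.
rewrite /dodgson !setE -t1 -t2 -r1 -r2.
pose z (i : 'I_(#|E| + #|V|)) : bool := match split i with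
  inl k => ~~ o (enum_val k) | inr _ => false end.
pose M := full_mx G (fun=> true).
have -> : full_mx G o = \matrix_(i, j) ((-1) ^+ z i * M i j * (-1) ^+ z j).
  have incE x u : incidence_entry G o x u =
      (-1) ^+ (~~ o x) * incidence_entry G (fun=> true) x u.
    rewrite /incidence_entry /edge_begin /edge_end.
    case: (o x); rewrite ?mul1r //.
    by case: eqP => //= _; case: eqP => //= _;
       rewrite /= ?mulr0 ?mulr1 ?mulrNN ?mulN1r ?opprK.
  have zl x : z (lshift _ x) = ~~ o (enum_val x).
    by rewrite /z (unsplitK (inl x)).
  have zr x : z (rshift _ x) = false by rewrite /z (unsplitK (inr x)).
  apply/matrixP=> i j; rewrite [RHS]mxE /M /full_mx.
  case: (split_ordP i) => x ->; case: (split_ordP j) => y ->;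
    rewrite ?zl ?zr ?mulr1 ?mul1r.
  - rewrite !block_mxEul !mxE; have [->|xy] := eqVneq x y; last first.
      by rewrite mulr0n mulr0 mul0r.
    by rewrite mulrC signrMK.
  - by rewrite !block_mxEur !mxE incE rmorphM /= rmorph_sign.
  - rewrite !block_mxEdl !mxE incE rmorphM /= rmorph_sign.
    by rewrite mulNr [in RHS]mulrC.
  - by rewrite !block_mxEdr !mxE.
apply: (eqpm_trans (det_remove_scale M z z _)).
  by rewrite !cardsE !(card_uniqP _) // !size_map.
apply: (eqpm_trans (det_remove_clear _ w1 w2)).
apply: (eqpm_trans (eqpm_sym (fdet_bij (clear r M) bh))).
suff -> : fdet (fun i j => clear r M (h i) (h j)) = fdet (clear t (net xvar)).
  exact: eqpm_refl.
apply: eq_fdet => i j; rewrite clear_map //; apply: eq_clear => {}i {}j _ _.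
have incE x u : (incidence_entry G (fun=> true) x u)%:~R = inc (epoly E) x u.
  rewrite /incidence_entry /inc /edge_begin /edge_end.
  by case: eqP => //= _; case: eqP => //= _; rewrite ?subrr ?subr0 ?sub0r.
case: i j => [x|u] [y|w]; rewrite /h /M /full_mx /edge_index /vertex_index /=.
- by rewrite block_mxEul !mxE (inj_eq enum_rank_inj) mulrb.
- by rewrite block_mxEur !mxE !enum_rankK incE.
- by rewrite block_mxEdl !mxE !enum_rankK incE.
- by rewrite block_mxEdr !mxE.
Qed.

End Network.

(** * Uniqueness of denominators up to sign *)

Lemma resultant_disc (R : comNzRingType) (a b c d : R) :
  (b * c - a * d) ^+ 2 = (a * d + b * c) ^+ 2 - 4%:R * (b * d) * (a * c).
Proof. ring. Qed.

Lemma resultant_scale (R : comNzRingType) (s t a b c d : R) :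
  s * a * (t * b) - s * c * (t * d) = s * t * (a * b - c * d).
Proof. ring. Qed.

Section InVar.
Variable E : finType.

HB.instance Definition _ (x : E) := GRing.RMorphism.copy (in_var x)
  (mmap (polyC \o @mpolyC #|{: E}| int)
       (fun i => if i == enum_rank x then 'X else ('X_i)%:P)).

Lemma in_var_self (x : E) : in_var x (xvar x) = 'X.
Proof. by rewrite /in_var /xvar mmapX mmap1U eqxx. Qed.

Lemma in_var_other (x y : E) : x != y -> in_var x (xvar y) = (xvar y)%:P.
Proof.
move=> xy; rewrite /in_var /xvar mmapX mmap1U (inj_eq enum_rank_inj).
by rewrite eq_sym (negbTE xy).
Qed.

Lemma resultant1_eqpm (x : E) (f f' g g' : epoly E) :
  eqpm f f' -> eqpm g g' -> eqpm (resultant1 x f g) (resultant1 x f' g').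
Proof.
case=> b -> [c ->]; exists (b (+) c).
rewrite /resultant1 !rmorphM !rmorph_sign /= signr_addb.
have coef_sign (d : bool) (p : {poly epoly E}) i :
    ((-1) ^+ d * p)`_i = (-1) ^+ d * p`_i.
  by case: d; rewrite ?mulN1r ?mul1r ?coefN.
move: (in_var x f') (in_var x g') => p q.
by rewrite !coef_sign resultant_scale.
Qed.

(** The square of the resultant is the discriminant of the product, hence
    independent of the factorization; in degree at most one the discriminant
    is the square of the linear coefficient. *)
Lemma resultant1_sqr (x : E) (D F H : epoly E) :
    at_most_linear x F -> at_most_linear x H -> D = F * H ->
  resultant1 x F H ^+ 2 = (in_var x D)`_1 ^+ 2
    - 4%:R * (in_var x D)`_2 * (in_var x D)`_0.
Proof.
move=> + + ->; rewrite /at_most_linear /resultant1 rmorphM /=.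
move: (in_var x F) (in_var x H) => p q p2 q2.
have big_coef (r : {poly epoly E}) : (size r <= 2)%N -> r`_2 = 0.
  by move=> r2; rewrite nth_default.
rewrite !coefM !big_ord_recl !big_ord0 /= /bump /=.
rewrite !(big_coef p) // !(big_coef q) //.
by rewrite !mulr0 !mul0r !addr0 !add0r resultant_disc.
Qed.

Lemma is_five_invariant_unique (V : finType) (G : mgraph V E) i j k l m P Q :
    uniq [:: i; j; k; l; m] ->
    is_five_invariant G i j k l m P -> is_five_invariant G i j k l m Q ->
  eqpm P Q.
Proof.
move=> u [o [v [b ->]]] [o' [v' [b' ->]]].
apply: (eqpm_trans (eqpm_sign _ _)); apply: eqpm_sym.
apply: (eqpm_trans (eqpm_sign _ _)); apply: eqpm_sym.
have set2_seq (x y : E) : [set x; y] = [set z in [:: x; y]].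
  by apply/setP=> z; rewrite !inE.
move: u; rewrite /= !inE !negb_or.
case/and5P=> [/and4P[ij ik il _] /and3P[jk jl _] /andP[kl _] _ _].
have indep x y z t : x != y -> z != t ->
    eqpm (dodgson G o v [set x; y] [set z; t])
         (dodgson G o' v' [set x; y] [set z; t]).
  move=> xy zt; rewrite !set2_seq.
  have u1 : uniq (unzip1 [:: (x, z); (y, t)]) by rewrite /= inE xy.
  have u2 : uniq (unzip2 [:: (x, z); (y, t)]) by rewrite /= inE zt.
  apply: (eqpm_trans (dodgson_clear G o v v u1 u2)); apply: eqpm_sym.
  exact: (dodgson_clear G o' v' v u1 u2).
by apply: resultant1_eqpm; apply: indep.
Qed.

(** Separates the two constructors of [is_denominator], since a list produced
    by a reduction step has at least six entries. *)
Lemma is_denominator_size (V : finType) (G : mgraph V E) es D :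
  is_denominator G es D -> (5 <= size es)%N.
Proof. by elim=> // {}es e {}D F H b _ n5 _ _ _ _; rewrite size_rcons ltnW. Qed.

Lemma is_denominator_unique (V : finType) (G : mgraph V E) es D D' :
  is_denominator G es D -> is_denominator G es D' -> eqpm D D'.
Proof.
move=> dD; elim: dD D' =>
  {es D} [i j k l m P u iP|es e D F H b dD IH ees DFH lF lH] D' dD'.
  move es5 : [:: i; j; k; l; m] dD' => es dD'.
  case: dD' es5 => [i' j' k' l' m' P' _ iP' [ei ej ek el em]|
    es' e' D0 F' H' b' d0 _ _ _ _ es5].
    by subst; apply: is_five_invariant_unique u iP iP'.
  by have := is_denominator_size d0; rewrite -ltnS -(size_rcons es' e') -es5.
move ees' : (rcons es e) dD' => es1 dD'.
case: dD' ees' => [i' j' k' l' m' P' _ _ es5|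
  es' e' D0 F' H' b' d0 _ DFH' lF' lH'].
  by have := is_denominator_size dD; rewrite -ltnS -(size_rcons es e) es5.
move/rcons_inj=> [ees' ee']; subst es' e'.
have /IH [c DD0] := d0.
(* the sign relating the two products disappears in the discriminant *)
have res2 : resultant1 e F H ^+ 2 = resultant1 e F' H' ^+ 2.
  have inD : in_var e D = (-1) ^+ c * in_var e D0.
    by rewrite DD0 rmorphM rmorph_sign.
  apply: etrans (resultant1_sqr lF lH DFH) _.
  apply: etrans _ (esym (resultant1_sqr lF' lH' DFH')).
  rewrite inD; move: (in_var e D0) => p.
  by case: (c); rewrite ?mul1r // mulN1r !coefN sqrrN !mulrN mulNr !opprK.
apply: (eqpm_trans (eqpm_sign _ _)); apply: eqpm_sym.
apply: (eqpm_trans (eqpm_sign _ _)); apply: eqpm_sym.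
move/eqP: res2; rewrite eqf_sqr.
by case/orP=> /eqP ->; [apply: eqpm_refl | apply: eqpm_opp].
Qed.

End InVar.

(** * Expansion in edge weights *)

Section Expand.
Variables (V E : finType) (G : mgraph V E) (R : comNzRingType).
Implicit Types (wt : E -> R).

Definition drop_weight wt (x : E) : E -> R :=
  fun y => if y == x then 0 else wt y.

Lemma eq_net_clear wt wt' s :
    (forall x, inl x \notin unzip1 s -> inl x \notin unzip2 s -> wt x = wt' x) ->
  fdet (clear s (net G wt)) = fdet (clear s (net G wt')).
Proof.
move=> ww; apply: eq_fdet; apply: eq_clear => -[x|v] [y|w] //= s1 s2.
by case: eqP s2 => // <- s2; rewrite ww.
Qed.

(** A weight occurs only in its diagonal entry.  The two terms are the matrices
    of the graph with the edge deleted and contracted. *)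
Lemma net_expand wt s x : inl x \notin unzip1 s -> inl x \notin unzip2 s ->
  fdet (clear s (net G wt)) =
    wt x * fdet (clear ((inl x, inl x) :: s) (net G (drop_weight wt x)))
    + fdet (clear s (net G (drop_weight wt x))).
Proof.
have inlE y : (inl y == inl x :> E + V) = (y == x) by [].
move=> s1 s2; rewrite (fdet_row _ s1) [in X in _ + X](fdet_row _ s1).
rewrite !(bigD1 (inl x) s2) /= /drop_weight !eqxx mul0r add0r; congr (_ * _ + _).
  by apply: eq_net_clear => y /=; rewrite inE inlE negb_or => /andP[/negbTE ->].
apply: eq_bigr => -[y|v] /andP[_ yx] /=; last first.
  congr (_ * _); apply: eq_net_clear => y /=.
  by rewrite inE inlE negb_or => /andP[/negbTE ->].
rewrite (_ : x == y = false) ?mul0r //; apply: contraNF yx => /eqP -> //.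
Qed.

End Expand.

(** * The graph with three new vertices and seven new edges *)

Section Attached.
Variables (V E : finType) (K : mgraph V E) (e : V) (R : comNzRingType).
Variable wt : attachE E -> R.

Definition old_part (x : attachE E) : R := if x is inl _ then wt x else 0.

Local Notation T := (attachE E + attachV V)%type.
(* The new edge numbered k+1 is [ne k]; its row and column are [ed k]. *)
Local Notation ne k := (inr (@Ordinal 7 k isT) : attachE E).
Local Notation ed k := (inl (ne k) : T).
Local Notation vf := (inr (new_f V) : T).
Local Notation vg := (inr (new_g V) : T).
Local Notation vh := (inr (new_h V) : T).
Local Notation old v := (inr (inl v) : T).

(** K together with the new edges as loops at e and the new vertices isolated.
    It provides a matrix on the index type of [attach], the same for all
    choices of the four attaching vertices. *)
Definition padded : mgraph (attachV V) (attachE E) := fun x =>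
  if x is inl y then (inl (K y).1, inl (K y).2) else (inl e, inl e).

Definition new_items : seq T :=
  [:: ed 0; ed 1; ed 2; ed 3; ed 4; ed 5; ed 6; vf; vg; vh].

Definition old_minor (s : seq (T * T)) : R :=
  fdet (clear ([seq (i, i) | i <- new_items] ++ s) (net padded old_part)).

Lemma old_eqE x y : (old x == old y) = (x == y).
Proof. by []. Qed.

Definition old_det : R := old_minor [:: (old e, old e)].
Definition old_cofactor (x y : V) : R :=
  old_minor [:: (old x, old y); (old e, old e)].

Lemma new_itemsP i : i \notin new_items ->
  (exists y : E, i = inl (inl y)) \/ (exists x : V, i = old x).
Proof.
case: i => [[y|[[|[|[|[|[|[|[|//]]]]]]] lt]]|[x|[[|[|[|//]]] lt]]] //= _.
  by left; exists y.
by right; exists x.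
Qed.

(** Up to the signs of the vertex lines the matrix is symmetric, and these
    signs occur once for the row and once for the column. *)
Lemma old_cofactor_sym x y : old_cofactor x y = old_cofactor y x.
Proof.
rewrite /old_cofactor /old_minor; set d := [seq (i, i) | i <- new_items].
pose sg (i : T) : R := if i is inl _ then 1 else -1.
rewrite -[LHS]fdet_clear_tr.
have -> : flip (d ++ [:: (old x, old y); (old e, old e)]) =
    d ++ [:: (old y, old x); (old e, old e)].
  by rewrite /flip map_cat -map_comp.
set s := _ ++ _.
have -> : fdet (clear s (fun i j => net padded old_part j i)) =
    fdet (fun i j => sg i * clear s (net padded old_part) i j * sg j).
  apply: eq_fdet => i j; rewrite !clearE; case: ifP => _; last first.
    case: i j => [i|i] [j|j];
      rewrite /sg /= ?mul1r ?mulr1 ?mulN1r ?mulrN1 ?opprK ?oppr0 //.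
    by rewrite eq_sym; case: eqP => // ->.
  have [ijs|] := boolP (_ \in s); last by rewrite mulr0 mul0r.
  rewrite mulr1; move: ijs; rewrite mem_cat => /orP[/mapP[k _ [-> ->]]|].
    by case: k => k; rewrite /sg ?mulr1 ?mulrNN ?mulr1.
  by rewrite !inE => /orP[] /eqP[-> ->]; rewrite /= mulrNN mulr1.
rewrite fdet_scale mulrAC -big_split big1 ?mul1r //= => -[i|i] _.
  by rewrite /sg mulr1.
by rewrite /sg mulrNN mulr1.
Qed.

(** For the side conditions of the pivot lemmas: the entries at all indices
    other than old vertices are decided by computation. *)
Ltac net_cases :=
  case=> [[y|[[|[|[|[|[|[|[|//]]]]]]] lt]]|[x|[[|[|[|//]]] lt]]] //= s1 s2;
  first [by [] | by rewrite /inc /= ?subrr ?subr0 ?oppr0 | idtac].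

Section Fixed.
Variables u v w z : V.
Hypotheses (ue : u != e) (we : w != e) (ze : z != e).
Local Notation G := (attach K e u v w z).
Local Notation N := (net G old_part).

(* The removed lines and the pivots in the coefficient of x_6 of Psi^{12,34},
   in reverse order, up to the pivot of u with edge 1 excluded. *)
Local Notation rest := ([:: (vg, ed 1); (ed 6, vg); (vh, ed 6); (ed 4, vf);
  (vf, ed 4); (ed 5, ed 5); (old e, old e); (ed 0, ed 2); (ed 1, ed 3)]
    : seq (T * T)).

(** Edges 5 and 7 are contracted, edge 6 is deleted.  Every step but one has a
    line with a single entry left; only the column of h still meets the two
    edges 3 and 4, and each of the two terms connects u with the other end of
    the edge that remains. *)
Lemma coef_x6_pivots :
  fdet (clear [:: (ed 5, ed 5); (old e, old e); (ed 0, ed 2); (ed 1, ed 3)] N) =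
  - fdet (clear [:: (ed 3, old z), (ed 2, vh), (old u, ed 0) & rest] N)
  - fdet (clear [:: (ed 2, old w), (ed 3, vh), (old u, ed 0) & rest] N).
Proof.
rewrite (@pivot_col _ _ _ _ vf (ed 4)); [|by []|by []|net_cases]; last first.
  rewrite /inc /= (_ : (inl e == inl x :> attachV V) = false) ?subrr ?oppr0 //.
  by apply: contraNF s1 => /eqP [->]; rewrite !inE eqxx ?orbT.
rewrite (@pivot_col _ _ _ _ (ed 4) vf); [|by []|by []|net_cases].
rewrite (@pivot_row _ _ _ _ vh (ed 6)); [|by []|by []|net_cases].
rewrite (@pivot_col _ _ _ _ (ed 6) vg); [|by []|by []|net_cases].
rewrite (@pivot_row _ _ _ _ vg (ed 1)); [|by []|by []|net_cases].
rewrite (@pivot_col _ _ _ _ (old u) (ed 0)); last first.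
- net_cases.
  rewrite /inc /= (_ : (inl u == inl x :> attachV V) = false) ?subrr ?oppr0 //.
  by apply: contraNF s2 => /eqP [->].
- by [].
- by rewrite /= !inE old_eqE (negbTE ue).
rewrite (@fdet_col2 _ _ _ _ (ed 2) (ed 3) vh);
  [|by []|by []|by []|by []|net_cases].
rewrite [X in _ * X + _](@pivot_row _ _ _ _ (ed 3) (old z)); last first.
- net_cases.
  rewrite /inc /= (_ : (inl z == inl x :> attachV V) = false) ?subrr ?oppr0 //.
  by apply: contraNF s2 => /eqP [->].
- by rewrite /= !inE !old_eqE (negbTE ze).
- by [].
rewrite [X in _ + _ * X](@pivot_row _ _ _ _ (ed 2) (old w)); last first.
- net_cases.
  rewrite /inc /= (_ : (inl w == inl x :> attachV V) = false) ?subrr ?oppr0 //.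
  by apply: contraNF s2 => /eqP [->].
- by rewrite /= !inE !old_eqE (negbTE we).
- by [].
rewrite /= /inc /= !(eqxx (inl _)).
set X := fdet _; set Y := fdet _ => /=; ring.
Qed.

(** Once the new lines are cleared, the attaching vertices are forgotten. *)
Lemma old_minorE s :
  fdet (clear ([seq (i, i) | i <- new_items] ++ s) N) = old_minor s.
Proof.
apply: eq_fdet; apply: eq_clear => i j.
have nin k (r : seq T) : k \notin new_items ++ r -> k \notin new_items.
  by apply: contra; rewrite mem_cat => ->.
move=> /(nin _ (unzip1 s)) i_old /(nin _ (unzip2 s)) j_old.
by case: (new_itemsP i_old) => -[x ->]; case: (new_itemsP j_old) => -[y ->].
Qed.

(** The two terms of the expansion differ by exchanging the roles of edges 3
    and 4, a transposition; therefore their difference appears, and not their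
    sum.  After exchanging rows so that u is paired with w or z, the remaining
    pairs are the same for both and contribute a common sign. *)
Lemma coef_x6_value : exists b : bool,
  fdet (clear [:: (ed 5, ed 5); (old e, old e); (ed 0, ed 2); (ed 1, ed 3)] N) =
  (-1) ^+ b * (old_cofactor u z - old_cofactor u w).
Proof.
pose t : seq (T * T) := [:: (ed 3, ed 0); (ed 2, vh); (vg, ed 1); (ed 6, vg);
  (vh, ed 6); (ed 4, vf); (vf, ed 4); (ed 5, ed 5); (ed 0, ed 2); (ed 1, ed 3)].
have u_new : uniq new_items by vm_compute.
have t1 : perm_eq (unzip1 t) new_items by vm_compute.
have t2 : perm_eq (unzip2 t) new_items by vm_compute.
have [b sgn] := clear_sign R u_new t1 t2.
have minorE x : fdet (clear (t ++ [:: (old u, old x); (old e, old e)]) N) =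
    (-1) ^+ b * old_cofactor u x.
  rewrite sgn.
  - by rewrite old_minorE.
  - by move=> i; apply: contraL; rewrite !inE => /orP[] /eqP ->.
  - by move=> i; apply: contraL; rewrite !inE => /orP[] /eqP ->.
have permE s1 s2 : perm_eq s1 s2 -> fdet (clear s1 N) = fdet (clear s2 N).
  by move=> s12; apply: eq_fdet; apply: clear_perm.
have restE x : fdet (clear (t ++ [:: (old u, old x); (old e, old e)]) N) =
    fdet (clear [:: (old u, old x), (ed 3, ed 0), (ed 2, vh) & rest] N).
  by apply: permE; apply/seq.permP => a /=; ring.
have u_rest (x : attachE E) (q : T) :
    old u \notin unzip1 ((inl x, q) :: rest).
  by rewrite /= !inE old_eqE (negbTE ue).
exists b; rewrite coef_x6_pivots mulrBr -!minorE !restE; congr (_ - _).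
  rewrite [in LHS](permE _
    [:: (ed 3, old z), (old u, ed 0), (ed 2, vh) & rest]); last first.
    by apply/seq.permP => a /=; ring.
  by rewrite [in LHS]fdet_swap; [rewrite opprK|by []|exact: u_rest|by []].
rewrite [in LHS](permE _
  [:: (ed 2, old w), (old u, ed 0), (ed 3, vh) & rest]); last first.
  by apply/seq.permP => a /=; ring.
rewrite [in LHS]fdet_swap; [|by []|exact: u_rest|by []].
rewrite [in LHS](permE _
  [:: (ed 2, ed 0), (ed 3, vh), (old u, old w) & rest]); last first.
  by apply/seq.permP => a /=; ring.
rewrite [in LHS]fdet_swap; [rewrite opprK|by []|by []|by []].
by apply: permE; apply/seq.permP => a /=; ring.
Qed.

(** Here every pivot is forced, and all of them are between new lines. *)
Lemma coef_x5x7_value :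
  eqpm (fdet (clear [:: (ed 4, ed 4); (ed 6, ed 6); (old e, old e);
                        (ed 0, ed 1); (ed 2, ed 3)] N))
       old_det.
Proof.
rewrite (@pivot_row _ _ _ _ vg (ed 5)); [|by []|by []|net_cases].
rewrite (@pivot_col _ _ _ _ (ed 5) vf); [|by []|by []|net_cases].
rewrite (@pivot_row _ _ _ _ vf (ed 0)); [|by []|by []|net_cases].
rewrite (@pivot_col _ _ _ _ (ed 3) vh); [|by []|by []|net_cases].
rewrite (@pivot_row _ _ _ _ vh (ed 2)); [|by []|by []|net_cases].
rewrite (@pivot_col _ _ _ _ (ed 1) vg); [|by []|by []|net_cases].
pose t : seq (T * T) := [:: (ed 1, vg); (vh, ed 2); (ed 3, vh); (vf, ed 0);
  (ed 5, vf); (vg, ed 5); (ed 4, ed 4); (ed 6, ed 6); (ed 0, ed 1); (ed 2, ed 3)].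
have u_new : uniq new_items by vm_compute.
have t1 : perm_eq (unzip1 t) new_items by vm_compute.
have t2 : perm_eq (unzip2 t) new_items by vm_compute.
have [b sgn] := clear_sign R u_new t1 t2.
have -> : fdet (clear [:: (ed 1, vg); (vh, ed 2); (ed 3, vh); (vf, ed 0);
    (ed 5, vf); (vg, ed 5); (ed 4, ed 4); (ed 6, ed 6); (old e, old e);
    (ed 0, ed 1); (ed 2, ed 3)] N) =
    fdet (clear (t ++ [:: (old e, old e)]) N).
  by apply: eq_fdet; apply: clear_perm; apply/seq.permP => a /=; ring.
rewrite sgn; first last.
- by move=> i; apply: contraL; rewrite !inE => /eqP ->.
- by move=> i; apply: contraL; rewrite !inE => /eqP ->.
rewrite old_minorE -/old_det; exists b.
rewrite /= /inc /= !subr0 !sub0r !opprK; move: old_det => X; ring.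
Qed.

(** The next three lemmas produce the vanishing monomials: the row or column of
    a new vertex is zero when the three edges at that vertex are cleared. *)
Lemma star_h_row0 (wt' : attachE E -> R) s :
    vh \notin unzip1 s -> ed 2 \in unzip2 s -> ed 3 \in unzip2 s ->
    ed 6 \in unzip2 s ->
  fdet (clear s (net G wt')) = 0.
Proof.
move=> sh s3 s4 s7; apply: (fdet_row0 (p := vh)) => //.
case=> [[y|[[|[|[|[|[|[|[|//]]]]]]] lt]]|[x|[[|[|[|//]]] lt]]] //=;
  rewrite ?(bool_irrelevance lt isT) ?s3 ?s4 ?s7 // /inc /= ?subrr ?oppr0 //.
Qed.

Lemma star_g_row0 (wt' : attachE E -> R) s :
    vg \notin unzip1 s -> ed 1 \in unzip2 s -> ed 5 \in unzip2 s ->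
    ed 6 \in unzip2 s ->
  fdet (clear s (net G wt')) = 0.
Proof.
move=> sh s3 s4 s7; apply: (fdet_row0 (p := vg)) => //.
case=> [[y|[[|[|[|[|[|[|[|//]]]]]]] lt]]|[x|[[|[|[|//]]] lt]]] //=;
  rewrite ?(bool_irrelevance lt isT) ?s3 ?s4 ?s7 // /inc /= ?subrr ?oppr0 //.
Qed.

Lemma star_f_col0 (wt' : attachE E -> R) s :
    vf \notin unzip2 s -> ed 0 \in unzip1 s -> ed 4 \in unzip1 s ->
    ed 5 \in unzip1 s ->
  fdet (clear s (net G wt')) = 0.
Proof.
move=> sh s3 s4 s7; apply: (fdet_col0 (q := vf)) => //.
case=> [[y|[[|[|[|[|[|[|[|//]]]]]]] lt]]|[x|[[|[|[|//]]] lt]]] //=;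
  rewrite ?(bool_irrelevance lt isT) ?s3 ?s4 ?s7 // /inc /= ?subrr ?oppr0 //.
Qed.

(** Nested in the order in which the weights are expanded below. *)
Definition drop_567 :=
  drop_weight (drop_weight (drop_weight wt (ne 6)) (ne 4)) (ne 5).

(** The weights of edges 1 to 4 never appear, as the row or the column of each
    of these edges is removed. *)
Lemma drop_567E s :
    ed 0 \in unzip1 s ++ unzip2 s -> ed 1 \in unzip1 s ++ unzip2 s ->
    ed 2 \in unzip1 s ++ unzip2 s -> ed 3 \in unzip1 s ++ unzip2 s ->
  fdet (clear s (net G drop_567)) = fdet (clear s N).
Proof.
move=> s0 s1 s2 s3; apply: eq_net_clear => x nx1 nx2.
have nx : inl x \notin unzip1 s ++ unzip2 s by rewrite mem_cat negb_or nx1.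
case: x {nx1 nx2} nx => [//|[[|[|[|[|[|[|[|//]]]]]]] lt]] //;
  rewrite ?(bool_irrelevance lt isT) ?s0 ?s1 ?s2 ?s3 //.
Qed.

(** The variable x_7 is absent because edges 3, 4, 7 form the star of h, and
    x_5 x_6 because edges 1, 5, 6 form the star of f. *)
Lemma dodgson_12_34_expand (s := [:: (old e, old e); (ed 0, ed 2); (ed 1, ed 3)]) :
  fdet (clear s (net G wt)) =
  fdet (clear s N) + wt (ne 4) * fdet (clear ((ed 4, ed 4) :: s) N)
                   + wt (ne 5) * fdet (clear ((ed 5, ed 5) :: s) N).
Proof.
rewrite (@net_expand _ _ _ _ _ _ (ne 6)) // star_h_row0 // mulr0 add0r.
rewrite (@net_expand _ _ _ _ _ _ (ne 4)) //.
rewrite [X in _ * X + _](@net_expand _ _ _ _ _ _ (ne 5)) //.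
rewrite (@star_f_col0 _ [:: (ed 5, ed 5), (ed 4, ed 4) & s]) // mulr0 add0r.
rewrite [X in _ + X](@net_expand _ _ _ _ _ _ (ne 5)) //.
rewrite -/drop_567 !drop_567E // /drop_weight /=.
by rewrite addrA addrC addrA.
Qed.

(** The star of f excludes x_5 x_6, and the star of g, formed by edges 2, 6, 7,
    excludes x_6 x_7. *)
Lemma dodgson_13_24_expand (s := [:: (old e, old e); (ed 0, ed 1); (ed 2, ed 3)]) :
  fdet (clear s (net G wt)) =
  fdet (clear s N) + wt (ne 4) * fdet (clear ((ed 4, ed 4) :: s) N)
                   + wt (ne 5) * fdet (clear ((ed 5, ed 5) :: s) N)
  + wt (ne 6) * (fdet (clear ((ed 6, ed 6) :: s) N)
       + wt (ne 4) * fdet (clear [:: (ed 4, ed 4), (ed 6, ed 6) & s] N)).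
Proof.
rewrite (@net_expand _ _ _ _ _ _ (ne 6)) //.
rewrite [X in _ * X + _](@net_expand _ _ _ _ _ _ (ne 4)) //.
rewrite [X in _ * (_ * X + _) + _](@net_expand _ _ _ _ _ _ (ne 5)) //.
rewrite (@star_f_col0 _ [:: (ed 5, ed 5), (ed 4, ed 4), (ed 6, ed 6) & s]) //.
rewrite mulr0 add0r.
rewrite [X in _ * (_ + X) + _](@net_expand _ _ _ _ _ _ (ne 5)) //.
rewrite (@star_g_row0 _ [:: (ed 5, ed 5), (ed 6, ed 6) & s]) // mulr0 add0r.
rewrite [X in _ + X](@net_expand _ _ _ _ _ s (ne 4)) //.
rewrite [X in _ + (_ * X + _)](@net_expand _ _ _ _ _ _ (ne 5)) //.
rewrite (@star_f_col0 _ [:: (ed 5, ed 5), (ed 4, ed 4) & s]) // mulr0 add0r.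
rewrite [X in _ + (_ + X)](@net_expand _ _ _ _ _ _ (ne 5)) //.
rewrite -/drop_567 !drop_567E // /drop_weight /=.
move: (fdet _) (fdet _) (fdet _) (fdet _) (fdet _) => *; ring.
Qed.

End Fixed.
End Attached.

(** * Elimination of three variables *)

Section Linear.
(* The morphism h stands for [in_var x].  The ring is kept abstract, as
   computing in a concrete ring of multivariate polynomials is slow. *)
Variables (S : comNzRingType) (h : {rmorphism S -> {poly S}}).
Implicit Types p q : S.

Definition coef_resultant p q : S := (h p)`_1 * (h q)`_0 - (h p)`_0 * (h q)`_1.

Definition free_of p := h p = p%:P.

Lemma free_ofD p q : free_of p -> free_of q -> free_of (p + q).
Proof. by rewrite /free_of rmorphD polyCD => -> ->. Qed.

Lemma free_ofB p q : free_of p -> free_of q -> free_of (p - q).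
Proof. by rewrite /free_of rmorphB polyCB => -> ->. Qed.

Lemma free_ofM p q : free_of p -> free_of q -> free_of (p * q).
Proof. by rewrite /free_of rmorphM polyCM => -> ->. Qed.

Lemma free_ofN p : free_of p -> free_of (- p).
Proof. by rewrite /free_of rmorphN polyCN => ->. Qed.

Lemma free_of0 : free_of 0.
Proof. by rewrite /free_of rmorph0 polyC0. Qed.

Lemma free_of_net (V E : finType) (G : mgraph V E) (wt : E -> S) s :
  (forall y, free_of (wt y)) -> free_of (fdet (clear s (net G wt))).
Proof.
move=> fw; rewrite /free_of !fdet_map; apply: eq_fdet => i j.
rewrite !clear_rmorph; apply: eq_clear => {}i {}j _ _.
have incE (k : {rmorphism S -> {poly S}}) y v : k (inc G S y v) = inc G _ y v.
  by rewrite /inc rmorphB !rmorph_nat.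
case: i j => [y|v] [y'|v'] /=; rewrite ?rmorphN ?incE ?rmorph0 //.
by case: eqP => _; rewrite ?rmorph0 // fw.
Qed.

Variable x : S.
Hypothesis hx : h x = 'X.

Lemma h_linear p q : free_of p -> free_of q -> h (p + x * q) = p%:P + 'X * q%:P.
Proof. by rewrite /free_of rmorphD rmorphM hx => -> ->. Qed.

Lemma coef0_linear p q : (p%:P + 'X * q%:P)`_0 = p.
Proof. by rewrite coefD coefC coefXM addr0. Qed.

Lemma coef1_linear p q : (p%:P + 'X * q%:P)`_1 = q.
Proof. by rewrite coefD coefC coefXM coefC add0r. Qed.

Lemma size_linear p q :
  free_of p -> free_of q -> (size (h (p + x * q)%R) <= 2)%N.
Proof.
move=> fp fq; rewrite h_linear //; apply/leq_sizeP => -[|[|j]] // _.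
by rewrite coefD coefC coefXM coefC addr0.
Qed.

Lemma coef_resultant_linear p q p' q' :
    free_of p -> free_of q -> free_of p' -> free_of q' ->
  coef_resultant (p + x * q) (p' + x * q') = q * p' - p * q'.
Proof.
move=> fp fq fp' fq'; rewrite /coef_resultant !h_linear //.
by rewrite !coef0_linear !coef1_linear.
Qed.

Lemma coef_resultant1 p q :
  free_of p -> free_of q -> coef_resultant (p + x * q) 1 = q.
Proof.
move=> fp fq; rewrite /coef_resultant h_linear // rmorph1.
by rewrite coef0_linear coef1_linear !coef1 mulr1 mulr0 subr0.
Qed.

End Linear.

(** In the resultant P of f and g with respect to x_5 no square of x_6 or x_7
    appears.  So P and then Q are linear, and with the second factor equal to 1
    each resultant just extracts a linear coefficient. *)
Lemma three_reductions (S : comNzRingType)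
    (h5 h6 h7 : {rmorphism S -> {poly S}}) (x5 x6 x7 A B C A' B' C' D' E' f g : S)
    (P := coef_resultant h5 f g) (Q := coef_resultant h6 P 1) :
    f = A + x5 * B + x6 * C ->
    g = A' + x5 * B' + x6 * C' + x7 * (D' + x5 * E') ->
    h5 x5 = 'X -> h6 x6 = 'X -> h7 x7 = 'X ->
    free_of h5 x6 -> free_of h5 x7 -> free_of h6 x7 ->
    (forall y, y \in [:: A; B; C; A'; B'; C'; D'; E'] ->
       [/\ free_of h5 y, free_of h6 y & free_of h7 y]) ->
  [/\ (size (h6 P) <= 2)%N, (size (h7 Q) <= 2)%N
    & coef_resultant h7 Q 1 = - (C * E')].
Proof.
move=> fE gE h5x h6x h7x f56 f57 f67 free.
pose in_all y := [/\ free_of h5 y, free_of h6 y & free_of h7 y].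
have [A5 A6 A7] := free A (mem_head _ _).
have [B5 B6 B7] : in_all B by apply: free; rewrite !inE eqxx ?orbT.
have [C5 C6 C7] : in_all C by apply: free; rewrite !inE eqxx ?orbT.
have [A'5 A'6 A'7] : in_all A' by apply: free; rewrite !inE eqxx ?orbT.
have [B'5 B'6 B'7] : in_all B' by apply: free; rewrite !inE eqxx ?orbT.
have [C'5 C'6 C'7] : in_all C' by apply: free; rewrite !inE eqxx ?orbT.
have [D'5 D'6 D'7] : in_all D' by apply: free; rewrite !inE eqxx ?orbT.
have [E'5 E'6 E'7] : in_all E' by apply: free; rewrite !inE eqxx ?orbT.
have PE : P = (B * (A' + x7 * D') - A * (B' + x7 * E'))
              + x6 * (B * C' - C * (B' + x7 * E')).
  rewrite /P (_ : f = (A + x6 * C) + x5 * B); last by rewrite fE; ring.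
  rewrite (_ : g = (A' + x6 * C' + x7 * D') + x5 * (B' + x7 * E')); last first.
    by rewrite gE; ring.
  by rewrite coef_resultant_linear //; [ring | ..];
     do ?[apply: free_ofD | apply: free_ofM].
have P0 : free_of h6 (B * (A' + x7 * D') - A * (B' + x7 * E')).
  by do ?[apply: free_ofB | apply: free_ofD | apply: free_ofM].
have P1 : free_of h6 (B * C' - C * (B' + x7 * E')).
  by do ?[apply: free_ofB | apply: free_ofD | apply: free_ofM].
have QE : Q = (B * C' - C * B') + x7 * - (C * E').
  by rewrite /Q PE (coef_resultant1 h6x) //; ring.
have Q0 : free_of h7 (B * C' - C * B').
  by do ?[apply: free_ofB | apply: free_ofM].
have Q1 : free_of h7 (- (C * E')) by apply: free_ofN; apply: free_ofM.
by rewrite QE {1}PE; split;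
  [apply: size_linear | apply: size_linear | apply: coef_resultant1].
Qed.

(** * The denominator of the seven new edges *)

Section Denominators.
Variables (V E : finType) (K : mgraph V E) (e u v w z : V).
Hypotheses (ue : u != e) (we : w != e) (ze : z != e).
Local Notation G := (attach K e u v w z).
Local Notation N := (net G (old_part (@xvar _))).
Local Notation ne k := (inr (@Ordinal 7 k isT) : attachE E).

Lemma free_of_old k s : free_of (in_var (inr k)) (fdet (clear s N)).
Proof.
apply: free_of_net => -[x|x] /=; first exact: in_var_other.
exact: free_of0.
Qed.

Lemma new_edgesE : new_edges E =
  rcons (rcons [:: ne 0; ne 1; ne 2; ne 3; ne 4] (ne 5)) (ne 6).
Proof.
rewrite /new_edges.
suff -> : enum 'I_7 = [:: @Ordinal 7 0 isT; @Ordinal 7 1 isT; @Ordinal 7 2 isT;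
  @Ordinal 7 3 isT; @Ordinal 7 4 isT; @Ordinal 7 5 isT; @Ordinal 7 6 isT] by [].
by apply: (inj_map val_inj); rewrite val_enum_ord.
Qed.


(** Reduction with the factorization P = P * 1. *)
Lemma is_denominator_linear (es : seq (attachE E)) x P :
    is_denominator G es P -> x \notin es -> (size (in_var x P) <= 2)%N ->
  is_denominator G (rcons es x) (resultant1 x P 1).
Proof.
move=> dP xes lP; rewrite -[resultant1 _ _ _]mul1r.
apply: (denominator_step false dP xes (esym (mulr1 P)) lP).
by rewrite /at_most_linear rmorph1 size_poly1.
Qed.

Local Notation old v := (inr (inl v) : attachE E + attachV V).
Local Notation ed k := (inl (ne k) : attachE E + attachV V).

(** The vertex v has dropped out: edge 2 was used as a pivot between new lines
    in both coefficients. *)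
Lemma denominator7_value : exists D, is_denominator G (new_edges E) D /\
  eqpm D (old_det K e (@xvar _) *
    (old_cofactor K e (@xvar _) u z - old_cofactor K e (@xvar _) u w)).
Proof.
pose o : orientation (attachE E) := fun=> true.
have set2E (x y : attachE E) : [set x; y] = [set t in [:: x; y]].
  by apply/setP=> t; rewrite !inE.
pose v0 : attachV V := inl e.
pose s12 := [:: (old e, old e); (ed 0, ed 2); (ed 1, ed 3)].
pose s13 := [:: (old e, old e); (ed 0, ed 1); (ed 2, ed 3)].
pose f := fdet (clear s12 (net G (@xvar _))).
pose g := fdet (clear s13 (net G (@xvar _))).
have df : eqpm (dodgson G o v0 [set ne 0; ne 1] [set ne 2; ne 3]) f.
  rewrite !set2E.
  exact: (@dodgson_clear _ _ G o v0 v0 [:: (ne 0, ne 2); (ne 1, ne 3)] isT isT).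
have dg : eqpm (dodgson G o v0 [set ne 0; ne 2] [set ne 1; ne 3]) g.
  rewrite !set2E.
  exact: (@dodgson_clear _ _ G o v0 v0 [:: (ne 0, ne 1); (ne 2, ne 3)] isT isT).
have fE := dodgson_12_34_expand K e (@xvar _) u v w z.
have gE := dodgson_13_24_expand K e (@xvar _) u v w z.
have [b CE] := coef_x6_value K (@xvar _) v ue we ze.
have [c EE] := coef_x5x7_value K e (@xvar _) u v w z.
pose P := resultant1 (ne 4) f g.
have dP : is_denominator G [:: ne 0; ne 1; ne 2; ne 3; ne 4] P.
  apply: denominator_five => //.
  have [s Ps] := resultant1_eqpm (ne 4) (eqpm_sym df) (eqpm_sym dg).
  by exists o, v0, s.
have [] := @three_reductions _ (in_var (ne 4)) (in_var (ne 5)) (in_var (ne 6))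
   (xvar (ne 4)) (xvar (ne 5)) (xvar (ne 6)) _ _ _ _ _ _ _ _ f g fE gE.
- exact: in_var_self.
- exact: in_var_self.
- exact: in_var_self.
- exact: in_var_other.
- exact: in_var_other.
- exact: in_var_other.
- have fr s : [/\ free_of (in_var (ne 4)) (fdet (clear s N)),
      free_of (in_var (ne 5)) (fdet (clear s N))
    & free_of (in_var (ne 6)) (fdet (clear s N))] by split; apply: free_of_old.
  by move=> y; rewrite !inE; do ?[case/orP; last move=> +];
     move=> /eqP ->; apply: fr.
move=> lP lQ D7E.
have dQ := @is_denominator_linear _ (ne 5) _ dP isT lP.
have dD := @is_denominator_linear _ (ne 6) _ dQ isT lQ.
rewrite new_edgesE.
exists (resultant1 (ne 6) (resultant1 (ne 5) P 1) 1); split=> //.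
apply: (eqpm_trans (y := - _)).
  by exists false; rewrite mul1r; exact: D7E.
rewrite CE EE.
apply: (eqpm_trans (eqpm_opp _)); rewrite mulrC.
by apply: eqpmM; apply: eqpm_sign.
Qed.

End Denominators.

Lemma four_term (R : comNzRingType) (t x y z w : R) :
  t * (x - y) - t * (z - w) + t * (y - w) - t * (x - z) = 0.
Proof. ring. Qed.

Theorem theorem45 (V E : finType) (K : mgraph V E) (a b c d e : V)
    (distinct_abcde : uniq [:: a; b; c; d; e]) :
  let G1 := attach K e d a b c in
  let G2 := attach K e a d b c in
  let G3 := attach K e b c a d in
  let G4 := attach K e c b a d in
  [/\ exists D : epoly (attachE E), is_denominator G1 (new_edges E) D,
      exists D : epoly (attachE E), is_denominator G2 (new_edges E) D,
      exists D : epoly (attachE E), is_denominator G3 (new_edges E) D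
    & exists D : epoly (attachE E), is_denominator G4 (new_edges E) D]
  /\
  (forall D1 D2 D3 D4 : epoly (attachE E),
     is_denominator G1 (new_edges E) D1 ->
     is_denominator G2 (new_edges E) D2 ->
     is_denominator G3 (new_edges E) D3 ->
     is_denominator G4 (new_edges E) D4 ->
     exists s1 s2 s3 s4 : bool,
       (-1) ^+ s1 * D1 + (-1) ^+ s2 * D2 + (-1) ^+ s3 * D3 + (-1) ^+ s4 * D4
       = 0).
Proof.
move=> G1 G2 G3 G4; move: distinct_abcde; rewrite /= !inE !negb_or.
case/and5P=> [/and4P[_ _ _ ae] /and3P[_ _ be] /andP[_ ce] de _].
have [E1 [d1 v1]] := denominator7_value K a de be ce.
have [E2 [d2 v2]] := denominator7_value K d ae be ce.
have [E3 [d3 v3]] := denominator7_value K c be ae de.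
have [E4 [d4 v4]] := denominator7_value K b ce ae de.
split; first by split; [exists E1 | exists E2 | exists E3 | exists E4].
move=> D1 D2 D3 D4 dD1 dD2 dD3 dD4.
have val G u w z D D0 :
    is_denominator G (new_edges E) D -> is_denominator G (new_edges E) D0 ->
    eqpm D0 (old_det K e (@xvar _) *
      (old_cofactor K e (@xvar _) u z - old_cofactor K e (@xvar _) u w)) ->
  exists s : bool, (-1) ^+ s * D = old_det K e (@xvar _) *
    (old_cofactor K e (@xvar _) u z - old_cofactor K e (@xvar _) u w).
  move=> dD dD0 v0; have [s ->] := eqpm_trans (is_denominator_unique dD dD0) v0.
  by exists s; rewrite signrMK.
have [s1 e1] := val _ _ _ _ _ _ _ dD1 d1 v1.
have [s2 e2] := val _ _ _ _ _ _ _ dD2 d2 v2.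
have [s3 e3] := val _ _ _ _ _ _ _ dD3 d3 v3.
have [s4 e4] := val _ _ _ _ _ _ _ dD4 d4 v4.
exists s1, (~~ s2), s3, (~~ s4).
have sN (s : bool) (D : epoly (attachE E)) :
    (-1) ^+ (~~ s) * D = - ((-1) ^+ s * D).
  by rewrite signrN mulNr.
rewrite !sN e1 e2 e3 e4.
rewrite (old_cofactor_sym K e _ b d) (old_cofactor_sym K e _ b a).
rewrite (old_cofactor_sym K e _ c d) (old_cofactor_sym K e _ c a).
exact: four_term.
Qed.
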